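(* Let $x,y$ be real numbers in $[-1,1]$, and for real $z$ let $$A=\begin{pmatrix} 1 & x & y \\ x & 1 & z \\ y & z & 1 \end{pmatrix}.$$ Then $A$ is a valid correlation matrix if and only if $$z\in\Big[xy-\sqrt{(1-x^2)(1-y^2)},\;xy+\sqrt{(1-x^2)(1-y^2)}\Big].$$
   Context: A (real, symmetric, unit-diagonal) matrix is called a valid correlation matrix if it is positive-semidefinite. *)

(* Defs.v *)
From mathcomp Require Import all_boot all_order all_algebra.
From mathcomp Require Import reals.

Set Implicit Arguments.
Unset Strict Implicit.
Unset Printing Implicit Defensive.

Import Order.TTheory GRing.Theory Num.Theory.
Local Open Scope ring_scope.

Definition psd (R : realType) (n : nat) (A : 'M[R]_n) : Prop :=
  forall v : 'cV[R]_n, 0 <= (v^T *m A *m v) 0 0.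

Definition correlation_matrix (R : realType) (n : nat) (A : 'M[R]_n) : Prop :=
  [/\ A \is symmetricmx, (forall i, A i i = 1) & psd A].

Definition corr3 (R : realType) (x y z : R) : 'M[R]_3 :=
  \matrix_(i < 3, j < 3)
    (nth [::] [:: [:: 1; x; y];
                  [:: x; 1; z];
                  [:: y; z; 1]] i)`_j.

(* Main.v *)
(** Completing the square in the first variable, the quadratic form of the
    matrix is [(a + x b + y c)^2] plus the binary form
    [(1 - x^2) b^2 + 2 (z - x y) b c + (1 - y^2) c^2]; since [a] is free, it is
    nonnegative exactly when the binary form is, that is, when
    [(z - x y)^2 <= (1 - x^2) (1 - y^2)]. *)
Require Import Defs.
From mathcomp Require Import all_boot all_order all_algebra.
From mathcomp Require Import reals.
From mathcomp Require Import ring.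

Import Order.TTheory GRing.Theory Num.Theory.
Local Open Scope ring_scope.

Lemma binary_form_ge0P (R : realFieldType) (p r w : R) : 0 <= p -> 0 <= r ->
  (forall b c, 0 <= p * b ^+ 2 + r * c ^+ 2 + 2 * w * b * c) <->
  w ^+ 2 <= p * r.
Proof.
move=> p0 r0; split=> [form_ge0|w2_le b c].
  move: r0; rewrite le_eqVlt => /predU1P[r0|r_gt0].
    (* With [r = 0] the form is affine in [c]; this [c] makes [p * w ^+ 2] cancel and leaves
       [- w ^+ 2], even when [p = 0]. *)
    have := form_ge0 (- w) ((p + 1) / 2).
    rewrite -r0 (_ : _ + _ = - w ^+ 2); last by field.
    by rewrite mulr0 oppr_ge0.
  (* For [r > 0], the vector [(r, - w)] minimizes the form in [c] at [b = r], where its value is [r]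
     times the determinant [p * r - w ^+ 2]. *)
  have := form_ge0 r (- w).
  rewrite (_ : _ + _ = r * (p * r - w ^+ 2)); last by ring.
  by rewrite pmulr_rge0 // subr_ge0.
move: p0; rewrite le_eqVlt => /predU1P[p0|p_gt0].
  have /eqP w0 : w == 0 by rewrite -sqrf_eq0 eq_le sqr_ge0 andbT -(mul0r r) p0.
  by rewrite -p0 w0 mul0r add0r mulr0 !mul0r addr0 mulr_ge0 ?sqr_ge0.
(* Multiplying by [p > 0] completes the square in [b] without division. *)
rewrite -(pmulr_rge0 _ p_gt0).
rewrite [leRHS](_ : _ = (p * b + w * c) ^+ 2 + (p * r - w ^+ 2) * c ^+ 2);
  last by ring.
by apply: addr_ge0; [exact: sqr_ge0 | rewrite mulr_ge0 ?sqr_ge0 ?subr_ge0].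
Qed.

Lemma corr3_form (R : realType) (x y z : R) (v : 'cV[R]_3) :
  let a := v 0 0 in let b := v 1 0 in let c := v 2%:R 0 in
  (v^T *m corr3 x y z *m v) 0 0 =
  (a + x * b + y * c) ^+ 2 + ((1 - x ^+ 2) * b ^+ 2 + (1 - y ^+ 2) * c ^+ 2
    + 2 * (z - x * y) * b * c).
Proof.
move=> a b c; rewrite mxE !big_ord_recl big_ord0 !mxE.
rewrite !big_ord_recl !big_ord0 !mxE /=.
have -> : lift ord0 ord0 = 1 :> 'I_3 by apply: val_inj.
have -> : lift ord0 (lift ord0 ord0) = 2%:R :> 'I_3 by apply: val_inj.
by rewrite -/a -/b -/c; ring.
Qed.

Lemma corr3_sym (R : realType) (x y z : R) : corr3 x y z \is symmetricmx.
Proof.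
(* Symmetric means Hermitian with trivial conjugation and sign [(-1) ^+ 0], the factor that [mul1r]
   removes. *)
apply/is_hermitianmxP/matrixP.
by move=> [[|[|[|//]]] ?] [[|[|[|//]]] ?]; rewrite !mxE mul1r.
Qed.

Lemma corr3_diag (R : realType) (x y z : R) i : corr3 x y z i i = 1.
Proof. by case: i => [[|[|[|//]]] ?]; rewrite mxE. Qed.

Lemma psd_corr3P (R : realType) (x y z : R) :
  psd (corr3 x y z) <->
  (forall b c, 0 <= (1 - x ^+ 2) * b ^+ 2 + (1 - y ^+ 2) * c ^+ 2
    + 2 * (z - x * y) * b * c).
Proof.
split=> [psdA b c|form_ge0 v]; last first.
  by rewrite corr3_form addr_ge0 ?sqr_ge0.
(* The first coordinate is chosen to make the square in [corr3_form] vanish. *)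
have := psdA (\col_i [:: - (x * b + y * c); b; c]`_i).
by rewrite corr3_form !mxE /= -addrA addNr expr0n add0r.
Qed.

(** Membership says [|z - m| <= sqrt d]; writing the absolute value as [sqrt ((z - m) ^+ 2)] lets
    monotonicity of the root conclude. *)
Lemma mem_itv_sqrt (R : rcfType) (m d z : R) : 0 <= d ->
  (z \in `[m - Num.sqrt d, m + Num.sqrt d]) = ((z - m) ^+ 2 <= d).
Proof.
by move=> d0; rewrite in_itv /= -ler_distl -sqrtr_sqr ler_sqrt.
Qed.

Theorem proposition4p3 (R : realType) (x y : R)
    (hx : x \in `[-1, 1]) (hy : y \in `[-1, 1]) (z : R) :
  correlation_matrix (corr3 x y z) <->
  z \in `[x * y - Num.sqrt ((1 - x ^+ 2) * (1 - y ^+ 2)),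
          x * y + Num.sqrt ((1 - x ^+ 2) * (1 - y ^+ 2))].
Proof.
have sub_sqr_ge0 (t : R) : t \in `[-1, 1] -> 0 <= 1 - t ^+ 2.
  by rewrite in_itv /= subr_ge0 -ler_norml -real_normK ?num_real // expr_le1.
have p0 := sub_sqr_ge0 _ hx; have r0 := sub_sqr_ge0 _ hy.
rewrite mem_itv_sqrt ?mulr_ge0 //.
have [to_le of_le] := binary_form_ge0P _ _ _ (z - x * y) p0 r0.
have [to_form of_form] := psd_corr3P R x y z.
split=> [[_ _ /to_form/to_le]//|/of_le/of_form psdA].
by split=> [|i|//]; [exact: corr3_sym | exact: corr3_diag].
Qed.
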